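(* Let $M$ be a metrizable space of uncountable weight $\kappa$. (1) $\mathcal{K}(M)\ge_T[\kappa]^{<\omega}$. (2) $\mathcal{K}(M)=_T[\kappa]^{<\omega}$ if $M$ is locally compact. (3) If $M$ is not locally compact then $\mathcal{K}(M)\ge_T\omega^\omega\times[\kappa]^{<\omega}$. (4) If $M$ is completely metrizable then $([\kappa]^{<\omega})^{\omega}\ge_T\mathcal{K}(M)$. (5) If $\kappa<\aleph_\omega$, and $M$ is completely metrizable but not locally compact, then $\mathcal{K}(M)=_T([\kappa]^{<\omega})^{\omega}=_T\omega^\omega\times[\kappa]^{<\omega}$.
   Context: A directed set is a (nonempty) partially ordered set in which every finite subset has an upper bound. For directed sets $P,Q$, write $P\ge_T Q$ if there is a map $\phi:P\to Q$ carrying every cofinal subset of $P$ to a cofinal subset of $Q$; $P=_TQ$ means $P\ge_TQ$ and $Q\ge_TP$. For a space $X$, $\mathcal{K}(X)$ is the set of compact subsets of $X$ ordered by inclusion. $[\kappa]^{<\omega}$ is the set of finite subsets of $\kappa$ ordered by inclusion; products and powers (including $\omega^\omega$) carry the coordinatewise order. The weight of a space is the minimal size of a basis. *)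

(* Defs.v *)
(* MathComp / MathComp-Analysis world. *)
From HB Require Import structures.
From mathcomp Require Import all_boot all_order all_algebra.
From mathcomp Require Import all_classical all_reals all_analysis.

Set Implicit Arguments.
Unset Strict Implicit.
Unset Printing Implicit Defensive.

Local Open Scope classical_set_scope.
Local Open Scope card_scope.

(* Nonemptiness is the case A = set0 of dle_directed. *)
Record directedSet := DirectedSet {
  dcarrier :> Type;
  dle : dcarrier -> dcarrier -> Prop;
  dle_refl : forall x, dle x x;
  dle_anti : forall x y, dle x y -> dle y x -> x = y;
  dle_trans : forall y x z, dle x y -> dle y z -> dle x z;
  dle_directed : forall A : set dcarrier, finite_set A ->
    exists u, forall a, A a -> dle a u }.

Definition cofinal (P : directedSet) (C : set P) : Prop :=
  forall p : P, exists2 c, C c & dle p c.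

Definition tukey_ge (P Q : directedSet) : Prop :=
  exists phi : P -> Q, forall C : set P, cofinal C -> cofinal (phi @` C).

Definition tukey_eq (P Q : directedSet) : Prop :=
  tukey_ge P Q /\ tukey_ge Q P.

Notation "P '>=T' Q" := (tukey_ge P Q) (at level 70, no associativity).
Notation "P '=T' Q" := (tukey_eq P Q) (at level 70, no associativity).

Lemma finite_upper_bound (T : Type) (le : T -> T -> Prop) (x0 : T) :
  (forall x, le x x) -> (forall y x z, le x y -> le y z -> le x z) ->
  (forall x y, exists2 u, le x u & le y u) ->
  forall A : set T, finite_set A -> exists u, forall a, A a -> le a u.
Proof.
move=> lexx letr le2 A /(@finite_seqP {classic T})[s ->] {A}.
elim: s => [|b s [u us]]; first by exists x0.
have [v bv uv] := le2 b u.
by exists v => a /=; rewrite inE => /predU1P[->//|/us au]; exact: letr au uv.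
Qed.

Lemma nat_directed (A : set nat) : finite_set A ->
  exists u, forall a, A a -> (a <= u)%N.
Proof.
apply: (@finite_upper_bound nat (fun m n => (m <= n)%N) 0%N).
- by move=> n; exact: leqnn.
- by move=> n m p; exact: leq_trans.
- by move=> m n; exists (maxn m n); [exact: leq_maxl|exact: leq_maxr].
Qed.

Definition omega_dset : directedSet :=
  @DirectedSet nat (fun m n => (m <= n)%N) leqnn
    (fun m n mn nm => anti_leq (introT andP (conj mn nm)))
    (fun n m p => @leq_trans n m p) nat_directed.

Section SetFamily.
Variables (T : Type) (F : set (set T)).

Let fam := {A : set T | F A}.
Let fam_le (A B : fam) := sval A `<=` sval B.

Let fam_anti (A B : fam) : fam_le A B -> fam_le B A -> A = B.
Proof.
case: A B => [A FA] [B FB] /= AB BA.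
have eAB : A = B by exact/seteqP.
by subst B; congr exist; exact: Prop_irrelevance.
Qed.

Hypothesis (F0 : F set0) (FU : setU_closed F).

Let fam_directed (E : set fam) : finite_set E ->
  exists u, forall A, E A -> fam_le A u.
Proof.
apply: (@finite_upper_bound fam fam_le (exist _ set0 F0)).
- by move=> A.
- by move=> B A C AB BC; exact: subset_trans AB BC.
- move=> [A FA] [B FB]; exists (exist _ (A `|` B) (FU FA FB)).
    exact: subsetUl.
  exact: subsetUr.
Qed.

Definition inclusion_dset : directedSet :=
  @DirectedSet fam fam_le (fun A => @subset_refl T (sval A)) fam_anti
    (fun B A C => @subset_trans T (sval B) (sval A) (sval C)) fam_directed.

End SetFamily.

Lemma finite_setU_closed (K : Type) : setU_closed (@finite_set K).
Proof. by move=> A B fA fB; rewrite finite_setU. Qed.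

Definition fin_dset (K : Type) : directedSet :=
  inclusion_dset (@finite_set0 K) (@finite_setU_closed K).

Definition compact_dset (M : topologicalType) : directedSet :=
  inclusion_dset (@compact0 M) (@compactU M).

Section ProdDset.
Variables P Q : directedSet.

Let le2 (x y : P * Q) := dle x.1 y.1 /\ dle x.2 y.2.

Let le2_refl x : le2 x x. Proof. by split; exact: dle_refl. Qed.

Let le2_anti x y : le2 x y -> le2 y x -> x = y.
Proof.
case: x y => [x1 x2] [y1 y2] [/= xy1 xy2] [/= yx1 yx2].
by rewrite (dle_anti xy1 yx1) (dle_anti xy2 yx2).
Qed.

Let le2_trans y x z : le2 x y -> le2 y z -> le2 x z.
Proof. by move=> [? ?] [? ?]; split; apply: dle_trans; eassumption. Qed.

Let le2_directed (A : set (P * Q)) : finite_set A ->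
  exists u, forall a, A a -> le2 a u.
Proof.
move=> fA.
have [u uP] := dle_directed (finite_image fst fA).
have [v vP] := dle_directed (finite_image snd fA).
by exists (u, v) => a Aa; split; [apply: uP|apply: vP]; exists a.
Qed.

Definition prod_dset : directedSet :=
  DirectedSet le2_refl le2_anti le2_trans le2_directed.

End ProdDset.

Section PowDset.
Variable P : directedSet.

Let lep (f g : nat -> P) := forall n, dle (f n) (g n).

Let lep_refl f : lep f f. Proof. by move=> n; exact: dle_refl. Qed.

Let lep_anti f g : lep f g -> lep g f -> f = g.
Proof. by move=> fg gf; apply/funext => n; exact: dle_anti. Qed.

Let lep_trans g f h : lep f g -> lep g h -> lep f h.
Proof. by move=> fg gh n; exact: dle_trans (fg n) (gh n). Qed.

Let lep_directed (A : set (nat -> P)) : finite_set A ->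
  exists u, forall a, A a -> lep a u.
Proof.
move=> fA.
have /choice[u uP] n : exists u, forall a, A a -> dle (a n) u.
  have [u uP] := dle_directed (finite_image (fun f : nat -> P => f n) fA).
  by exists u => a Aa; apply: uP; exists a.
by exists u => a Aa n; exact: uP.
Qed.

Definition omega_power : directedSet :=
  DirectedSet lep_refl lep_anti lep_trans lep_directed.

End PowDset.

Definition homeomorphic (X Y : topologicalType) : Prop :=
  exists (f : X -> Y) (g : Y -> X),
    [/\ cancel f g, cancel g f, continuous f & continuous g].

Definition metrizable (R : realType) (M : topologicalType) : Prop :=
  exists N : metricType R, homeomorphic M N.

Definition completely_metrizable (R : realType) (M : topologicalType) : Prop :=
  exists2 N : metricType R,
    (forall F : set_system N, ProperFilter F -> cauchy F -> exists l : N, F --> l) &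
    homeomorphic M N.

(* A cardinal is represented by a type K of that cardinality. *)
Definition has_weight (M : topologicalType) (K : Type) : Prop :=
  (exists2 B : set (set M), basis B & B #= [set: K]) /\
  (forall B : set (set M), basis B -> [set: K] #<= B).

Definition card_lt (S T : Type) : Prop :=
  ([set: S] #<= [set: T]) /\ ~ ([set: T] #<= [set: S]).

(* T has cardinality aleph_n; aleph_(n+1) is the least cardinal above aleph_n. *)
Fixpoint is_aleph (n : nat) (T : Type) : Prop :=
  match n with
  | 0 => [set: T] #= [set: nat]
  | m.+1 => exists S : Type,
      [/\ is_aleph m S, card_lt S T &
          forall U : Type, card_lt S U -> [set: T] #<= [set: U]]
  end.

(* aleph_omega is the supremum of the aleph_n. *)
Definition is_aleph_omega (T : Type) : Prop :=
  (forall n (S : Type), is_aleph n S -> [set: S] #<= [set: T]) /\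
  (forall U : Type, (forall n (S : Type), is_aleph n S -> [set: S] #<= [set: U]) ->
    [set: T] #<= [set: U]).

Definition lt_aleph_omega (K : Type) : Prop :=
  exists2 T : Type, is_aleph_omega T & card_lt K T.

(* Main.v *)
(* Tukey reductions are built in the form of tukey_geP: phi : P -> Q such that
   every q is below phi p' for all large p'.
   (1) Maximal 1/(n+1)-separated sets D_n yield a basis of balls, so K injects
   into the triples (n, k, d) with d in D_n, and a compact set meets each D_n
   in a finite set.
   (2) Send a finite set of indices of relatively compact basic sets to the
   union of their closures.
   (3) Around a point without compact neighbourhood, each closed ball of radius
   1/(n+1) contains a sequence y n meeting every compact set finitely often;
   f in omega^omega is sent to the fan {x} U {y n k | k <= f n}.
   (4) In a complete space, sequences (G_n) of finite subsets of a dense set give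
   compact sets by intersecting over n the closed 1/(n+1)-neighbourhoods of G_n.
   (5) It remains to reduce ([K]^<omega)^omega to omega^omega x [K]^<omega, by
   induction on n for |K| <= aleph_n: the union of a sequence of finite subsets
   of aleph_(n+1) is bounded by some s, and below s the induction hypothesis
   applies; s itself is recorded in the finite component. *)
Require Import Defs.
From HB Require Import structures.
From mathcomp Require Import all_boot all_order all_algebra.
From mathcomp Require Import all_classical all_reals all_analysis.

Set Implicit Arguments.
Unset Strict Implicit.
Unset Printing Implicit Defensive.

Import Order.TTheory GRing.Theory Num.Theory.
Local Open Scope classical_set_scope.
Local Open Scope card_scope.

(** * Tukey reductions between directed sets *)

(** If no [p] works for some [q], the [p] with [q] not below [phi p] form a cofinal set whose image
    has nothing above [q]. *)
Lemma tukey_geP (P Q : directedSet) : P >=T Q <->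
  exists phi : P -> Q,
    forall q, exists p, forall p', dle p p' -> dle q (phi p').
Proof.
split=> -[phi phiP]; exists phi.
  move=> q; apply: contrapT => /forallNP noP.
  have [|_ [p np <-] //] := phiP [set p | ~ dle q (phi p)] _ q.
  move=> p; have /existsNP[p' /not_implyP[pp' np']] := noP p.
  by exists p'.
move=> C cofC q; have [p pq] := phiP q; have [c Cc pc] := cofC p.
by exists (phi c); [exists c|exact: pq].
Qed.

Lemma tukey_ge_trans (Q P S : directedSet) : P >=T Q -> Q >=T S -> P >=T S.
Proof.
move=> [f fP] [g gQ]; exists (g \o f) => C /fP/gQ.
by rewrite image_comp.
Qed.

Lemma dle_upper2 (P : directedSet) (x y : P) : exists2 u, dle x u & dle y u.
Proof.
have [|u uP] := @dle_directed P [set x; y].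
  by rewrite finite_setU; split; exact: finite_set1.
by exists u; apply: uP; [left|right].
Qed.

Lemma tukey_ge_prod (P Q S : directedSet) :
  P >=T Q -> P >=T S -> P >=T prod_dset Q S.
Proof.
move=> /tukey_geP[f fP] /tukey_geP[g gP]; apply/tukey_geP.
exists (fun p => (f p, g p)) => -[q s].
have [p fp] := fP q; have [p' gp'] := gP s.
have [u pu p'u] := dle_upper2 p p'; exists u => v uv; split => /=.
  exact/fp/(dle_trans pu).
exact/gp'/(dle_trans p'u).
Qed.

(** The hypothesis says that [psi] sends unbounded sets to unbounded sets; choosing bounds for the
    preimages of down-sets gives the map from [P] to [Q]. *)
Lemma tukey_geI (P Q : directedSet) (psi : Q -> P) :
  (forall p, exists q, forall q', dle (psi q') p -> dle q' q) -> P >=T Q.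
Proof.
move=> /choice[phi phiP]; apply/tukey_geP; exists phi => q.
by exists (psi q) => p; exact: phiP.
Qed.

(** * Comparison and arithmetic of infinite cardinals *)

(** An injective relation stands in for an injection, so no default value in [U] is required off
    [A]. *)
Lemma card_le_rel {T U} {A : set T} {B : set U} (G : T -> U -> Prop) :
  (forall x, A x -> exists2 y, B y & G x y) ->
  (forall x x' y, A x -> A x' -> G x y -> G x' y -> x = x') -> A #<= B.
Proof.
move=> totG injG.
have /choice[f fP] (a : A) : exists b : B, G (val a) (val b).
  case: a => a /= Aa; have [b Bb Gab] := totG _ (set_mem Aa).
  by exists (SigSub (mem_set Bb)).
apply/card_leP/injfunPex; exists f => // a a' _ _ faa'; apply: val_inj.
apply: (injG _ _ (val (f a))) => //; first exact: set_valP.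
  exact: set_valP.
by rewrite faa'.
Qed.

Lemma card_le_relP {T U} {A : set T} {B : set U} : A #<= B ->
  exists G : T -> U -> Prop,
    (forall x, A x -> exists2 y, B y & G x y) /\
    (forall x x' y, G x y -> G x' y -> x = x').
Proof.
move=> /card_leP/injfunPex[f _ finj].
exists (fun x y => exists2 a : A, val a = x & val (f a) = y); split.
  move=> x Ax; exists (val (f (SigSub (mem_set Ax)))); first exact: set_valP.
  by eexists; last reflexivity.
move=> _ _ _ [a <- <-] [a' <- /val_inj/finj ->] //; exact: mem_set.
Qed.

Definition partial_injection {S T} (G : set (S * T)) :=
  (forall x y y', G (x, y) -> G (x, y') -> y = y') /\
  (forall x x' y, G (x, y) -> G (x', y) -> x = x').

(** Two pairs in the union of a chain lie in a single member, so conditions on two pairs survive;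
    this is the chain condition for Zorn's lemma. *)
Lemma partial_injection_bigcup {S T} (F : set (set (S * T))) :
  F `<=` partial_injection -> total_on F subset ->
  partial_injection (\bigcup_(G in F) G).
Proof.
move=> Finj Ftot.
have common p q : (\bigcup_(G in F) G) p -> (\bigcup_(G in F) G) q ->
    exists G, [/\ partial_injection G, G p & G q].
  move=> [G FG Gp] [H FH Hq]; have [GH|HG] := Ftot _ _ FG FH.
    by exists H; split; [exact: Finj|exact: GH|].
  by exists G; split; [exact: Finj| |exact: HG].
split.
  by move=> x y y' xy xy'; have [G [[+ _]]] := common _ _ xy xy'; apply.
by move=> x x' y xy x'y; have [G [[_ +]]] := common _ _ xy x'y; apply.
Qed.

(** A maximal partial injection exhausts one side: an unmatched [x] and an unmatched [y] could be
    added as a pair. *)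
Lemma card_le_total (S T : Type) :
  [set: S] #<= [set: T] \/ [set: T] #<= [set: S].
Proof.
have [G [[Gfun Ginj] Gmax]] :=
  Zorn_bigcup (@partial_injection_bigcup S T).
have [Gdom|/existsNP[x nx]] := pselect (forall x, exists y, G (x, y)).
  left; apply: (@card_le_rel _ _ _ _ (fun x y => G (x, y))) => //.
    by move=> x _; have [y] := Gdom x; exists y.
  by move=> x x' y _ _; exact: Ginj.
have [Grng|/existsNP[y ny]] := pselect (forall y, exists x, G (x, y)).
  right; apply: (@card_le_rel _ _ _ _ (fun y x => G (x, y))) => //.
    by move=> y _; have [x0] := Grng y; exists x0.
  by move=> y y' x0 _ _; exact: Gfun.
exfalso; apply: (Gmax (G `|` [set (x, y)])).
  split; first exact: subsetUl.
  by move=> /(_ (x, y) (or_intror erefl)) Gxy; apply: nx; exists y.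
split.
- move=> a b b' [Gab|[-> ->]] [Gab'|[]]; first exact: Gfun Gab Gab'.
  + by move=> ax; case: nx; exists b; rewrite -ax.
  + by case: nx; exists b'.
  + by move=> ->.
- move=> a a' b [Gab|[-> ->]] [Ga'b|[]]; first exact: Ginj Gab Ga'b.
  + by move=> _ bx; case: ny; exists a; rewrite -bx.
  + by case: ny; exists a'.
  + by move=> ->.
Qed.

(* A maximal injection G of A x nat into A, with A included in S, leaves only
   finitely many points of S outside A: otherwise a countably infinite set
   disjoint from A could be added to A. *)
Lemma card_prod_nat_le (S : Type) : infinite_set [set: S] ->
  [set: S * nat] #<= [set: S].
Proof.
move=> Sinf.
(* [absorbing] makes the domain of [G] a product of some [A] with nat and puts the range inside that
   [A]. *)
pose absorbing (G : set ((S * nat) * S)) :=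
  (forall a n s, G ((a, n), s) -> forall m, exists t, G ((a, m), t)) /\
  (forall p s, G (p, s) -> exists t, G ((s, 0%N), t)).
have [G [[Ginj [Gdom Grng]] Gmax]] : exists G,
    (partial_injection G /\ absorbing G) /\
    forall H, G `<` H -> ~ (partial_injection H /\ absorbing H).
  apply: (@Zorn_bigcup _ (fun G => partial_injection G /\ absorbing G))
    => F FP Ftot.
  split; first by apply: partial_injection_bigcup => // G /FP[].
  split.
    move=> a n s [G FG Gans] m; have [_ [+ _]] := FP _ FG.
    by move=> /(_ _ _ _ Gans m)[t Gt]; exists t, G.
  move=> p s [G FG Gps]; have [_ [_ +]] := FP _ FG.
  by move=> /(_ _ _ Gps)[t Gt]; exists t, G.
pose A := [set a | exists t, G ((a, 0%N), t)].
have Atot a n : A a -> exists s, G ((a, n), s).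
  by move=> [t /Gdom]; exact.
have cA : finite_set (~` A).
  apply: contrapT => /infiniteP/card_le_relP[J [Jtot Jinj]].
  have /choice[j jP] n : exists a, ~ A a /\ J n a.
    by have [//|a nAa Jna] := Jtot n; exists a.
  have jA n : ~ A (j n) by case: (jP n).
  have jinj : injective j.
    move=> n m e; apply: (Jinj _ _ (j n)); first by case: (jP n).
    by rewrite e; case: (jP m).
  pose J' := [set ((j i.1, i.2), j (choice.pickle i)) | i in [set: nat * nat]].
  apply: (Gmax (G `|` J')).
    split; first exact: subsetUl.
    move=> /(_ ((j 0%N, 0%N), j (choice.pickle (0%N, 0%N)))) G0.
    by apply: (jA 0%N); eexists; apply: G0; right; exists (0%N, 0%N).
  have GJl a n s i : G ((a, n), s) -> j i <> a.
    by move=> + e; rewrite -e => /Gdom/(_ 0%N)[t Gt]; apply: (jA i); exists t.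
  have GJr p s i : G (p, s) -> j i <> s.
    by move=> + e; rewrite -e => /Grng[t Gt]; apply: (jA i); exists t.
  split; split.
  - move=> [a n] s s' [Gs|[i _ [+ + <-]]] [Gs'|[i' _ [+ + <-]]].
    + exact: Ginj.1 Gs Gs'.
    + by move=> /(GJl _ _ _ _ Gs).
    + by move=> /(GJl _ _ _ _ Gs').
    + by case: i i' => [? ?] [? ?] /= /[swap] -> <- /jinj -> ->.
  - move=> [a n] [a' n'] s [Gs|[i _ [<- <- <-]]] [Gs'|[i' _ [<- <- +]]].
    + exact: Ginj.2 Gs Gs'.
    + by move=> /(GJr _ _ _ Gs).
    + by have := GJr _ _ (choice.pickle i) Gs'.
    + by move=> /jinj/(pcan_inj choice.pickleK) ->.
  - move=> a n s [/Gdom Gs m|[i _ [<- _ _]] m].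
      by have [t Gt] := Gs m; exists t; left.
    by exists (j (choice.pickle (i.1, m))); right; exists (i.1, m).
  - move=> p s [/Grng[t Gt]|[i _ [_ <-]]].
      by exists t; left.
    exists (j (choice.pickle (choice.pickle i, 0%N))); right.
    by exists (choice.pickle i, 0%N).
have [a0 Aa0] : exists a, A a.
  apply: contrapT => /forallNP nA; apply: Sinf; apply: sub_finite_set cA.
  by move=> a _; exact: nA.
have /countable_injP[c cinj] : countable (~` A) by exact: finite_set_countable.
(* Points of [A] use the even columns; the finitely many others are coded into the odd columns over
   [a0]. *)
apply: (@card_le_rel _ _ _ _ (fun p s =>
  (A p.1 /\ G ((p.1, p.2.*2), s)) \/
  (~ A p.1 /\ G ((a0, (choice.pickle (c p.1, p.2)).*2.+1), s)))).
  move=> [a n] _ /=; have [Aa|nAa] := pselect (A a).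
    by have [s Gs] := Atot _ n.*2 Aa; exists s => //; left.
  have [s Gs] := Atot _ (choice.pickle (c a, n)).*2.+1 Aa0.
  by exists s => //; right.
have even_odd n m : n.*2 <> m.*2.+1.
  by move=> /(congr1 odd); rewrite /= !odd_double.
move=> [a n] [b m] s _ _ /= [[Aa Ga]|[nAa Ga]] [[Ab Gb]|[nAb Gb]];
  have := Ginj.2 _ _ _ Ga Gb.
- by move=> [-> /double_inj ->].
- by move=> [_ /even_odd].
- by move=> [_ /esym/even_odd].
- move=> [/double_inj/(pcan_inj choice.pickleK)[+ ->]].
  by move=> /(cinj _ _ (mem_set nAa) (mem_set nAb)) ->.
Qed.

(** A point goes to its image for one index paired with the code of that index, which lands in
    [S * nat]. *)
Lemma card_bigcup_le {I T S : Type} (D : set I) (A : I -> set T) :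
  infinite_set [set: S] -> countable D ->
  (forall i, D i -> A i #<= [set: S]) ->
  \bigcup_(i in D) A i #<= [set: S].
Proof.
move=> Sinf /countable_injP[c cinj] AS.
apply: card_le_trans (card_prod_nat_le Sinf).
have /choice[G GP] (i : I) : exists G : T -> S -> Prop, D i ->
    (forall x, A i x -> exists2 y, [set: S] y & G x y) /\
    (forall x x' y, G x y -> G x' y -> x = x').
  have [Di|nDi] := pselect (D i); last by exists (fun _ _ => True).
  by have [G GP] := card_le_relP (AS _ Di); exists G.
apply: (@card_le_rel _ _ _ _
  (fun x p => exists i, [/\ D i, c i = p.2 & G i x p.1])).
  move=> x [i Di Aix]; have [y _ Gxy] := (GP _ Di).1 _ Aix.
  by exists (y, c i) => //; exists i.
move=> x x' [y n] _ _ [i [/= Di <- Gi]] [k [/= Dk ck Gk]].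
have ki := cinj _ _ (mem_set Dk) (mem_set Di) ck.
by rewrite ki in Gk; exact: (GP _ Di).2 Gi Gk.
Qed.

Lemma is_aleph_infinite n (S : Type) : is_aleph n S -> infinite_set [set: S].
Proof.
elim: n S => [|n IH] S /=.
  by move=> /card_eqPle[_ natS]; apply/infiniteP.
move=> [S0 [/IH/infiniteP natS [S0S _] _]].
exact/infiniteP/(card_le_trans natS).
Qed.

(* If some initial segment of a well-order of K is not of size at most S, then K
   injects into the least such segment, and the order is pulled back to K. *)
Lemma small_segments_order (K S : Type) :
  infinite_set [set: S] -> ~ ([set: K] #<= [set: S]) ->
  (forall A : set K, A #<= [set: S] \/ [set: K] #<= A) ->
  exists r : K -> K -> Prop,
    (forall s, [set x | r x s] #<= [set: S]) /\
    (forall C : set K, countable C -> exists s, forall x, C x -> r x s).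
Proof.
move=> Sinf KS small.
have [W Wwo] := wochoice.well_ordering_principle {classic K}.
have Wtot (x y : K) : W x y \/ W y x.
  by apply/orP; apply: (wochoice.wo_chainW (wochoice.withinW Wwo)).
have Wanti (x y : K) : W x y -> W y x -> x = y.
  move=> xy yx; apply: (wochoice.wo_chain_antisymmetric (wochoice.withinW Wwo)).
  - exact: isT.
  - exact: isT.
  - by rewrite xy yx.
pose seg t := [set x : K | W x t /\ x <> t].
have [f finj segf] : exists2 f : K -> K, injective f &
    forall s, seg (f s) #<= [set: S].
  have [?|/existsNP[t1 bad1]] := pselect (forall t, seg t #<= [set: S]).
    by exists id.
  have [|t0 [[/asboolP bad0 min0] _]] :=
      Wwo (fun t => `[< ~ (seg t #<= [set: S]) >]).
    by exists t1; apply/asboolP.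
  have [//|/card_le_relP[G [Gtot Ginj]]] := small (seg t0).
  have /choice[f fP] x : exists y, seg t0 y /\ G x y.
    by have [//|y] := Gtot x; exists y.
  exists f.
    move=> x y e; apply: (Ginj _ _ (f x)); first by case: (fP x).
    by rewrite e; case: (fP y).
  move=> s; apply: contrapT => bad.
  have [[Wft nft] _] := fP s.
  have Wtf : W t0 (f s) by apply: min0; apply/asboolP.
  by apply: nft; exact: Wanti.
have strict s : [set x | seg (f s) (f x)] #<= [set: S].
  apply: card_le_trans (segf s).
  apply: (@card_le_rel _ _ _ _ (fun x y => f x = y)).
    by move=> x fx; exists (f x).
  by move=> x x' y _ _ <- /finj.
exists (fun x s => W (f x) (f s)); split=> [s|C cC].
  have natS := (infiniteP _).1 Sinf.
  apply: card_le_trans (card_bigcup_le (D := [set: bool])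
    (A := fun b => if b then [set x | seg (f s) (f x)] else [set s]) Sinf _ _).
  - apply: subset_card_le => x /= Wxs.
    have [->|nxs] := pselect (x = s); first by exists false.
    by exists true => //; split=> // /finj.
  - exact: countableP.
  - move=> [] _; first exact: strict.
    exact: card_le_trans (countable1 s) natS.
(* If no [s] bounds [C], each [s] lies strictly below a member of [C], so [K] is a countable union
   of sets of size at most [S]. *)
apply: contrapT => /forallNP unb; apply: KS.
apply: card_le_trans (card_bigcup_le (D := C) Sinf cC (fun x _ => strict x)).
apply: subset_card_le => s _.
have /existsNP[x /not_implyP[Cx nW]] := unb s.
exists x => //; have [//|Wsx] := Wtot (f x) (f s).
by split => // e; apply: nW; rewrite e in Wsx *.
Qed.

(** * The reduction of ([K]^<omega)^omega to omega^omega x [K]^<omega *)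

Definition prod_ge_omega_power (K : Type) :=
  prod_dset (omega_power omega_dset) (fin_dset K) >=T omega_power (fin_dset K).

(** The points with code below [m] form a finite set, and every finite set lies in one of these, so
    a function on nat dominates a sequence of finite sets. *)
Lemma prod_ge_omega_power_countable (K : Type) :
  countable [set: K] -> prod_ge_omega_power K.
Proof.
move=> /countable_injP[c cinj]; apply/tukey_geP.
have fin m : finite_set (c @^-1` `I_m).
  apply: finite_preimage (finite_II m) => x y _ _; apply: cinj; exact: mem_set.
exists (fun p n => exist _ _ (fin (p.1 n))) => F.
have /choice[g gP] n : exists m, sval (F n) `<=` c @^-1` `I_m.
  have [u uP] := nat_directed (finite_image c (svalP (F n))).
  by exists u.+1 => x Fx /=; rewrite ltnS; apply: uP; exists x.
exists (g, exist _ set0 (@finite_set0 K)) => -[h H] [/= gh _] n x /gP /=.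
by move=> /leq_trans; apply; exact: gh.
Qed.

(** The map cannot see which [s] bounds the sequence, so it joins the answers for all [s] in the
    finite component. This union is finite, and large enough once the right [s] is recorded. *)
Lemma prod_ge_omega_power_segments (K : Type) (r : K -> K -> Prop) :
  (forall s, prod_ge_omega_power {x | r x s}) ->
  (forall C : set K, countable C -> exists s, forall x, C x -> r x s) ->
  prod_ge_omega_power K.
Proof.
move=> segK bndK; apply/tukey_geP.
have /all_sig[phi phiP] s := cid ((tukey_geP _ _).1 (segK s)).
have restr_fin s (A : fin_dset K) : finite_set (@sval K (r^~ s) @^-1` sval A).
  apply: finite_preimage (svalP A) => x y _ _ /eq_sig_hprop.
  by apply => ? ? ?; exact: Prop_irrelevance.
pose restr s (A : fin_dset K) : fin_dset {x | r x s} :=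
  exist _ _ (restr_fin s A).
have ext_fin (p : prod_dset (omega_power omega_dset) (fin_dset K)) n : finite_set
    (\bigcup_(s in sval p.2) (sval @` sval (phi s (p.1, restr s p.2) n))).
  by apply: bigcup_finite (svalP p.2) _ => s _; exact: finite_image (svalP _).
exists (fun p n => exist _ _ (ext_fin p n)) => F.
have [s sP] : exists s, forall x, (\bigcup_n sval (F n)) x -> r x s.
  apply: bndK; apply: bigcup_countable => // n _.
  exact: finite_set_countable (svalP (F n)).
have [[g G] gG] := phiP s (fun n => restr s (F n)).
have Gs_fin : finite_set (sval @` sval G `|` [set s]).
  rewrite finite_setU; split; last exact: finite_set1.
  exact: finite_image (svalP G).
exists (g, exist _ _ Gs_fin) => -[h H] [/= gh GH] n x Fx /=.
exists s; first by apply: GH; right.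
have rxs : r x s by apply: sP; exists n.
exists (exist _ x rxs) => //; apply: (gG (h, restr s H)) => //.
split; first exact: gh.
hnf=> y Gy /=; apply: GH; left; by exists y.
Qed.

Lemma prod_ge_omega_power_aleph n (S K : Type) :
  is_aleph n S -> [set: K] #<= [set: S] -> prod_ge_omega_power K.
Proof.
elim: n S K => [|n IH] S K /=.
  move=> /card_eqPle[Snat _] KS; apply: prod_ge_omega_power_countable.
  exact: card_le_trans KS Snat.
move=> [S0 [aS0 _ minS]] KS.
have [/(IH _ _ aS0)//|KS0] := pselect ([set: K] #<= [set: S0]).
(* A subset too big for [S0] is strictly above it, so minimality of [S] makes it at least as large
   as [S], hence as [K]. *)
have small (A : set K) : A #<= [set: S0] \/ [set: K] #<= A.
  have [AS0|nAS0] := pselect (A #<= [set: S0]); first by left.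
  have [cAT cTA] := (card_eqPle _ _).1 (card_setT A).
  have nAS0' : ~ ([set: A] #<= [set: S0]) by move=> /(card_le_trans cTA)/nAS0.
  right; apply: card_le_trans KS _; apply: card_le_trans cAT; apply: minS.
  by split=> //; have [//|] := card_le_total S0 A.
have [r [segr bndr]] := small_segments_order (is_aleph_infinite aS0) KS0 small.
apply: prod_ge_omega_power_segments bndr => s; apply: IH aS0 _.
apply: card_le_trans (segr s).
apply: (@card_le_rel _ _ _ _ (fun x y => sval x = y)).
  by move=> [x rx] _; exists x.
move=> x y _ _ _ <- /esym /eq_sig_hprop.
by apply => ? ? ?; exact: Prop_irrelevance.
Qed.

(** By leastness of aleph_omega, some aleph_n does not embed in [K]; comparability then embeds [K]
    in it. *)
Lemma prod_ge_omega_power_lt_aleph_omega (K : Type) :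
  lt_aleph_omega K -> prod_ge_omega_power K.
Proof.
move=> [T [_ minT] [_ TK]].
have [n [S [aS nSK]]] : exists n S, is_aleph n S /\ ~ ([set: S] #<= [set: K]).
  apply: contrapT => noS; apply: TK; apply: minT => n S aS.
  by apply: contrapT => nSK; apply: noS; exists n, S.
by apply: prod_ge_omega_power_aleph aS _; have [|//] := card_le_total K S.
Qed.

(** * Invariance under homeomorphism, and bases indexed by the weight *)

Lemma homeomorphic_sym (X Y : topologicalType) :
  homeomorphic X Y -> homeomorphic Y X.
Proof. by move=> [f [g [fK gK fc gc]]]; exists g, f. Qed.

Lemma compact_image (X Y : topologicalType) (f : X -> Y) (L : set X) :
  continuous f -> compact L -> compact (f @` L).
Proof.
move=> fc cL; apply: continuous_compact => //.
by apply: continuous_subspaceT => x; exact: fc.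
Qed.

Lemma homeomorphic_compact_ge (X Y : topologicalType) :
  homeomorphic X Y -> compact_dset X >=T compact_dset Y.
Proof.
move=> [f [g [fK gK fc gc]]]; apply/tukey_geP.
exists (fun L => exist _ _ (compact_image fc (svalP L))) => L.
exists (exist _ _ (compact_image gc (svalP L))) => L' /= gLL' y Ly /=.
by exists (g y) => //; apply: gLL'; exists y.
Qed.

Lemma locally_compactTP (X : topologicalType) :
  locally_compact [set: X] <->
  forall x : X, exists2 U, nbhs x U & precompact U.
Proof.
split=> [lc x|lc x _].
  have [U + [cU clU]] := lc x I.
  rewrite /within /= => xU; exists U; last by exists U.
  by apply: filterS xU => y; exact.
have [U xU [V UV [cV clV]]] := lc x.
by exists V; [apply: filterS xU => y Uy _; exact: UV|split].
Qed.

Lemma homeomorphic_locally_compact (X Y : topologicalType) :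
  homeomorphic X Y -> locally_compact [set: X] -> locally_compact [set: Y].
Proof.
move=> [f [g [fK gK fc gc]]] /locally_compactTP lc; apply/locally_compactTP.
have fE (A : set X) : f @` A = g @^-1` A.
  apply/seteqP; split=> [_ [x Ax <-]|y Ay]; first by rewrite /= fK.
  by exists (g y).
move=> y; have [U xU [V UV [cV clV]]] := lc (g y).
exists (g @^-1` U); first exact: gc.
exists (g @^-1` V); first by move=> z; exact: UV.
split; first by rewrite -fE; exact: compact_image.
by apply: (continuous_closedP _).1 clV.
Qed.

Lemma homeomorphic_weight (X Y : topologicalType) (K : Type) :
  homeomorphic X Y -> has_weight X K -> has_weight Y K.
Proof.
move=> hXY.
have preim (X' Y' : topologicalType) (B : set (set X')) :
    homeomorphic X' Y' -> basis B ->
    exists g : Y' -> X', injective (fun A : set X' => g @^-1` A) /\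
      basis [set g @^-1` A | A in B].
  move=> [f [g [fK gK fc gc]]] [Bop Bb]; exists g; split.
    move=> A A' e; apply/seteqP; split=> x.
      by have := congr1 (fun C => C (f x)) e; rewrite /= fK => ->.
    by have := congr1 (fun C => C (f x)) e; rewrite /= fK => ->.
  split.
    by move=> _ [A BA <-]; apply: (continuousP _).1 (Bop _ BA).
  move=> y U yU; have /Bb[A [BA Ay] AU] : nbhs (g y) (f @^-1` U).
    by apply: fc; rewrite gK.
  exists (g @^-1` A); first by split=> //; exists A.
  by move=> z /AU /=; rewrite gK.
move=> [[B Bb BK] minK]; split.
  have [g [ginj gb]] := preim _ _ _ hXY Bb.
  exists [set g @^-1` A | A in B] => //; apply: card_eq_trans BK.
  by apply: inj_card_eq => A A' _ _; exact: ginj.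
move=> B' B'b; have [f [_ fb]] := preim _ _ _ (homeomorphic_sym hXY) B'b.
exact: card_le_trans (minK _ fb) (card_image_le _ _).
Qed.

Lemma weight_basis (X : topologicalType) (K : Type) :
  has_weight X K -> [set: K] !=set0 -> exists b : K -> set X, basis (range b).
Proof.
move=> [[B Bb BK] _] [k _].
have /pfcard_geP[B0|[f]] : B #<= [set: K] by have [] := (card_eqPle _ _).1 BK.
  move: BK; rewrite B0 card_eq_sym card_eq0 => /eqP K0.
  by have : set0 k by rewrite -K0.
exists f; suff -> : range f = B by [].
by apply/seteqP; split=> [_ [x _ <-]|A /(@surj _ _ _ _ f)//]; exact: funS.
Qed.

(** * Compactness through ultrafilters and covers *)

Lemma ultra_bigcup (T I : Type) (F : set_system T) (D : set I)
    (A : I -> set T) : UltraFilter F -> finite_set D ->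
  F (\bigcup_(i in D) A i) -> exists2 i, D i & F (A i).
Proof.
move=> FU /(@finite_seqP {classic I})[s ->] {D}; elim: s => [|i s IH] Fs.
  by have [x [j]] := filter_ex Fs; rewrite /= in_nil.
have [FAi|nFAi] := in_ultra_setVsetC (A i) FU.
  by exists i => //=; rewrite mem_head.
have [|j js FAj] := IH; last by exists j => //=; rewrite in_cons js orbT.
apply: filterS (filterI Fs nFAi) => x [[j + Ajx] nAix].
by rewrite /= in_cons => /predU1P[ji|js]; [rewrite ji in Ajx|exists j].
Qed.

Lemma compact_bigcup (X : topologicalType) (I : Type) (D : set I)
    (A : I -> set X) : finite_set D -> (forall i, D i -> compact (A i)) ->
  compact (\bigcup_(i in D) A i).
Proof.
move=> finD cA; rewrite compact_ultra => F FU FA.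
have [i Di FAi] := ultra_bigcup FU finD FA.
have := cA _ Di; rewrite compact_ultra => /(_ F FU FAi)[x [Aix Fx]].
by exists x; split=> //; exists i.
Qed.

(** Otherwise the sets left over by finite subfamilies generate a proper filter; its cluster point
    lies in some open [f i], which misses the member [L] minus [f i]. *)
Lemma compact_finite_subcover (X : topologicalType) (I : Type) (L : set X)
    (D : set I) (f : I -> set X) : compact L ->
  (forall i, D i -> open (f i)) -> L `<=` \bigcup_(i in D) f i ->
  exists F : set I, [/\ finite_set F, F `<=` D & L `<=` \bigcup_(i in F) f i].
Proof.
move=> cL fop Lf; apply: contrapT => noF.
pose rests := filter_from [set F : set I | finite_set F /\ F `<=` D]
  (fun F => L `\` \bigcup_(i in F) f i).
have rests_proper : ProperFilter rests.
  apply: filter_from_proper; last first.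
    move=> F [finF FD]; apply: contrapT => none; apply: noF.
    exists F; split=> // x Lx.
    by apply: contrapT => nx; apply: none; exists x.
  apply: filter_from_filter; first by exists set0; split=> //; exact: finite_set0.
  move=> F G [finF FD] [finG GD]; exists (F `|` G).
    by split; [rewrite finite_setU|rewrite subUset].
  by rewrite bigcup_setU setDUr.
have [|x [Lx clx]] := cL rests rests_proper.
  by exists set0 => [|y []//]; split=> //; exact: finite_set0.
have [i Di fix_] := Lf _ Lx.
have [||y [[_ ny] fy]] := clx (L `\` f i) (f i).
- exists [set i]; first by split=> [|_ ->//]; exact: finite_set1.
  by rewrite bigcup_set1.
- by apply: open_nbhs_nbhs; split=> //; exact: fop.
- exact: ny.
Qed.

Lemma fin_ge_compact (X : topologicalType) (K : Type) (b : K -> set X) :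
  basis (range b) -> locally_compact [set: X] ->
  fin_dset K >=T compact_dset X.
Proof.
move=> [bop bb] /locally_compactTP lc; apply/tukey_geP.
pose D := [set i | precompact (b i)].
have cG (G : fin_dset K) : compact (\bigcup_(i in sval G `&` D) closure (b i)).
  apply: compact_bigcup.
    exact: sub_finite_set (@subIsetl _ _ _) (svalP G).
  by move=> i [_]; rewrite /D /= precompactE.
exists (fun G => exist _ _ (cG G)) => L.
have [||F [finF FD LF]] := @compact_finite_subcover _ _ (sval L) D b (svalP L).
- by move=> i _; apply: bop; exists i.
- move=> x Lx; have [U xU pU] := lc x.
  have [_ [[i _ <-] ix] iU] := bb x _ xU.
  by exists i => //; exact: precompact_subset pU.
exists (exist _ F finF) => G FG; hnf=> x /LF[i Fi bix] /=.
by exists i; [split; [exact: FG|exact: FD]|exact: subset_closure].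
Qed.

(** [h] codes indices by compact sets. A compact [L] contains finitely many codes, and these bound
    every finite [F] whose union of codes lies in [L]. *)
Lemma compact_ge_fin (X : topologicalType) (K : Type) (h : K -> set X) :
  (forall a, compact (h a)) ->
  (forall L, compact L -> finite_set [set a | h a `<=` L]) ->
  compact_dset X >=T fin_dset K.
Proof.
move=> ch finh.
have cF (F : fin_dset K) : compact (\bigcup_(a in sval F) h a).
  exact: compact_bigcup (svalP F) _.
apply: (tukey_geI (psi := fun F => exist _ _ (cF F) : compact_dset X)) => L.
exists (exist _ _ (finh _ (svalP L))) => F FL; hnf=> a Fa /= x hx.
by apply: FL; exists a.
Qed.

(** An ultrafilter on [A] that does not converge to [x] contains a finite set, so it converges to a
    point of that set. *)
Lemma compact_punctured_finite (X : topologicalType) (A : set X) (x : X) :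
  A x -> (forall U, nbhs x U -> finite_set (A `\` U)) -> compact A.
Proof.
move=> Ax finA; rewrite compact_ultra => F FU FA.
have [Fx|/existsNP[U /not_implyP[xU nFU]]] := pselect (F --> x); first by exists x.
have [//|FUc] := in_ultra_setVsetC U FU.
have := finite_compact (finA U xU).
rewrite compact_ultra => /(_ F FU)[|l [[Al _] Fl]]; last by exists l.
by rewrite setDE; exact: filterI.
Qed.

(** * Separated sets and total boundedness in metric spaces *)

Section Metric.
Context {R : realType} {N : metricType R}.
Implicit Types (A L S : set N) (x : N) (e : R).
Local Open Scope ring_scope.

Lemma open_ball x e : open (ball x e).
Proof.
rewrite openE => y; rewrite /interior ballEmdist /= => xy.
apply/nbhs_ballP; exists (e - mdist x y); first by rewrite /= subr_gt0.
move=> z; rewrite ballEmdist /= ltrBrDl; apply: le_lt_trans.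
exact: metric_triangle.
Qed.

Lemma closure_ball x e : 0 < e -> closure (ball x e) `<=` ball x (e + e).
Proof.
move=> e0 y /(_ _ (nbhsx_ballx _ _ e0))[z [xz yz]].
exact: ball_triangle xz (ball_sym yz).
Qed.

Lemma ex_inv_lt e : 0 < e -> exists n : nat, n.+1%:R^-1 < e.
Proof.
move=> e0; have [n] := ltr_add_invr e0.
by rewrite add0r; exists n.
Qed.

Lemma inv_gt0 n : 0 < n.+1%:R^-1 :> R. Proof. by rewrite invr_gt0. Qed.

Definition e_separated e S := forall x y, S x -> S y -> ball x e y -> x = y.

Definition totally_bounded A := forall e, 0 < e ->
  exists2 C : set N, finite_set C & A `<=` \bigcup_(c in C) ball c e.

Lemma maximal_separated A e : exists S,
  [/\ S `<=` A, e_separated e S & 0 < e -> A `<=` \bigcup_(s in S) ball s e].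
Proof.
have [S [[SA Ssep] Smax]] : exists S, (S `<=` A /\ e_separated e S) /\
    forall S', S `<` S' -> ~ (S' `<=` A /\ e_separated e S').
  apply: (@Zorn_bigcup _ (fun S => S `<=` A /\ e_separated e S)).
  move=> F FP Ftot; split.
    by move=> x [S /FP[SA _] /SA].
  move=> x y [S FS Sx] [S' FS' S'y].
  have [SS'|S'S] := Ftot _ _ FS FS'.
    by apply: (FP _ FS').2 => //; exact: SS'.
  by apply: (FP _ FS).2 => //; exact: S'S.
exists S; split=> // e0 x Ax; apply: contrapT => nSx.
have far s : S s -> ~ ball s e x by move=> Ss sx; apply: nSx; exists s.
apply: (Smax (S `|` [set x])).
  split; first exact: subsetUl.
  move=> /(_ x (or_intror erefl)) Sx; apply: (far _ Sx); exact: ballxx.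
split; first by move=> y [/SA//|->].
move=> y z [Sy|->] [Sz|->] //; first exact: Ssep.
- by move=> /far.
- by move=> /ball_sym/far.
Qed.

Lemma compact_totally_bounded L : compact L -> totally_bounded L.
Proof.
move=> cL e e0.
have [||F [finF _ LF]] :=
  @compact_finite_subcover _ _ L setT (fun x => ball x e) cL.
- by move=> x _; exact: open_ball.
- by move=> x _; exists x => //; exact: ballxx.
by exists F.
Qed.

(** Two points of [S] in one ball of radius [e / 2] are within [e], hence equal, and finitely many
    such balls cover [L]. *)
Lemma compact_separated_finite L S e : 0 < e -> compact L ->
  e_separated e S -> finite_set (L `&` S).
Proof.
move=> e0 /compact_totally_bounded tbL Ssep.
have [C finC LC] := tbL (e / 2) (divr_gt0 e0 (ltr0Sn _ 1)).
have : finite_set (\bigcup_(c in C) (S `&` ball c (e / 2))).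
  apply: bigcup_finite => // c _.
  have [[s [Ss cs]]|none] := pselect (exists s, S s /\ ball c (e / 2) s).
    apply: (@sub_finite_set _ _ [set s]); last exact: finite_set1.
    by move=> t [St ct]; apply: Ssep => //; exact: ball_splitr ct cs.
  apply: (@sub_finite_set _ _ set0); last exact: finite_set0.
  by move=> t [St ct]; apply: none; exists t.
apply: sub_finite_set => x [Lx Sx].
by have [c Cc cx] := LC _ Lx; exists c.
Qed.

Lemma separated_sequence S e : 0 < e -> e_separated e S -> infinite_set S ->
  exists2 y : nat -> N, forall n, S (y n) &
    forall L, compact L -> finite_set (y @^-1` L).
Proof.
move=> e0 Ssep /infiniteP/card_le_relP[G [Gtot Ginj]].
have /choice[y yP] n : exists x, S x /\ G n x.
  by have [//|x] := Gtot n; exists x.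
exists y => [n|L cL]; first by case: (yP n).
have -> : y @^-1` L = y @^-1` (L `&` S).
  by apply/seteqP; split=> n /= => [Ln|[]//]; split=> //; case: (yP n).
apply: finite_preimage; last exact: compact_separated_finite e0 cL Ssep.
move=> n m _ _ e1; apply: (Ginj _ _ (y n)); first by case: (yP n).
by rewrite e1; case: (yP m).
Qed.

Lemma ultra_totally_bounded A (F : set_system N) : UltraFilter F ->
  F A -> totally_bounded A -> forall e, 0 < e -> exists x, F (ball x e).
Proof.
move=> FU FA tbA e e0; have [C finC AC] := tbA _ e0.
have FC : F (\bigcup_(c in C) ball c e) by exact: filterS FA.
by have [c _ Fc] := ultra_bigcup FU finC FC; exists c.
Qed.

Lemma complete_totally_bounded_compact A :
  (forall F : set_system N, ProperFilter F -> cauchy F ->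
    exists l : N, F --> l) ->
  closed A -> totally_bounded A -> compact A.
Proof.
move=> Ncomplete clA tbA; rewrite compact_ultra => F FU FA.
have [l Fl] : exists l : N, F --> l.
  by apply: Ncomplete; apply: cauchy_exP; exact: ultra_totally_bounded FA tbA.
exists l; split=> //; apply: clA => U /Fl FU'.
exact: (filter_ex (filterI FA FU')).
Qed.

(** Completeness is not assumed, so noncompactness has two sources: an infinite separated set, or a
    Cauchy ultrafilter with no limit in [A]. *)
Lemma noncompact_sequence A : closed A -> ~ compact A ->
  exists2 y : nat -> N, forall n, A (y n) &
    forall L, compact L -> finite_set (y @^-1` L).
Proof.
move=> clA ncA; have [tbA|] := pselect (totally_bounded A); last first.
  move=> /existsNP[e /not_implyP[e0 ncov]].
  have [S [SA Ssep /(_ e0) Scov]] := maximal_separated A e.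
  have Sinf : infinite_set S by move=> finS; apply: ncov; exists S.
  have [y yS yL] := separated_sequence e0 Ssep Sinf.
  by exists y => // n; exact/SA.
(* An ultrafilter witnessing noncompactness is Cauchy; a sequence chosen along
   it cannot accumulate, since F would converge to the accumulation point. *)
have [F [FU FA noF]] : exists F : set_system N,
    [/\ UltraFilter F, F A & forall l, A l -> ~ F --> l].
  apply: contrapT => noF; apply: ncA; rewrite compact_ultra => F FU FA.
  apply: contrapT => nl; apply: noF; exists F; split=> // l Al Fl.
  by apply: nl; exists l.
have /choice[c cP] n : exists x, F (ball x n.+1%:R^-1).
  exact: ultra_totally_bounded FA tbA _ (inv_gt0 n).
have FI n : F (A `&` [set x | forall i, (i <= n)%N -> ball (c i) i.+1%:R^-1 x]).
  apply: filterI => //; elim: n => [|n IH].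
    by apply: filterS (cP 0%N) => x cx i; rewrite leqn0 => /eqP ->.
  apply: filterS (filterI IH (cP n.+1)) => x [cx cnx] i.
  by rewrite leq_eqVlt => /predU1P[->//|]; exact: cx.
have /choice[y yP] n : exists x,
    A x /\ forall i, (i <= n)%N -> ball (c i) i.+1%:R^-1 x.
  exact: (filter_ex (FI n)).
exists y => [n|L cL]; first by case: (yP n).
apply: contrapT => infL.
have tail m : exists2 n, (m <= n)%N & L (y n).
  apply: contrapT => no; apply: infL.
  apply: sub_finite_set (finite_II m) => n Ln /=.
  by rewrite ltnNge; apply/negP => mn; apply: no; exists n.
(* Tails are restricted to indices landing in [L], so that compactness of [L] yields a cluster point
   [l]. *)
pose tl m := [set y n | n in [set n | (m <= n)%N /\ L (y n)]].
pose tails := filter_from [set: nat] tl.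
have tails_proper : ProperFilter tails.
  apply: filter_from_proper; last first.
    by move=> m _; have [n mn Ln] := tail m; exists (y n), n.
  apply: filter_fromT_filter; first by exists 0%N.
  move=> i j; exists (maxn i j) => _ [n [+ Ln] <-].
  rewrite geq_max => /andP[im jn].
  by split; exists n.
have [|l [Ll cl]] := cL tails tails_proper.
  by exists 0%N => // _ [n [_ Ln] <-].
have freq U m : nbhs l U -> exists2 n, (m <= n)%N & U (y n).
  move=> lU; have [|_ [[n [mn _] <-] Uy]] := cl (tl m) _ _ lU.
    by exists m.
  by exists n.
have Al : A l.
  apply: clA => U /(freq _ 0%N)[n _ Uy]; exists (y n); split=> //.
  by case: (yP n).
apply: (noF l Al) => U /nbhs_ballP[e /= e0 eU].
(* The bound [e] splits as [e / 2] from [l] to [y n], then a quarter to [c m] and a quarter to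
   [z]. *)
have e4 : 0 < e / 2 / 2 by rewrite !divr_gt0.
have [m me] := ex_inv_lt e4.
have [n mn ly] := freq _ m (nbhsx_ballx l _ (divr_gt0 e0 (ltr0Sn _ 1))).
apply: filterS (cP m) => z cz; apply: eU; rewrite [e]splitr.
apply: ball_triangle ly _; rewrite [e / 2]splitr.
apply: (@ball_triangle _ _ (c m)); last exact: le_ball (ltW me) _ cz.
apply: ball_sym; apply: le_ball (ltW me) _ _.
by have [_ /(_ _ mn)] := yP n.
Qed.

(** * Tukey reductions for compact subsets of a metric space *)

Lemma compact_ge_omega_power : ~ locally_compact [set: N] ->
  compact_dset N >=T omega_power omega_dset.
Proof.
move=> /locally_compactTP/existsNP[x nx].
have /choice[y yP] n : exists y : nat -> N,
    (forall k, closure (ball x n.+1%:R^-1) (y k)) /\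
    forall L, compact L -> finite_set (y @^-1` L).
  have [||y] := @noncompact_sequence (closure (ball x n.+1%:R^-1)).
  - exact: closed_closure.
  - move=> cB; apply: nx.
    exists (ball x n.+1%:R^-1); last by rewrite precompactE.
    exact/nbhsx_ballx/inv_gt0.
  - by exists y.
pose fan (f : nat -> nat) :=
  [set x] `|` [set y p.1 p.2 | p in [set p | (p.2 <= f p.1)%N]].
have cfan f : compact (fan f).
  apply: (@compact_punctured_finite _ _ x); first by left.
  move=> U /nbhs_ballP[e /= e0 eU].
  (* The closure of a ball lies in the ball of twice the radius, so radii below [e / 2] keep the
     rows from [m] on inside [U]. *)
  have [m me] := ex_inv_lt (divr_gt0 e0 (ltr0Sn R 1)).
  apply: (@sub_finite_set _ _ (\bigcup_(n in `I_m) (y n @` `I_(f n).+1))); last first.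
    apply: bigcup_finite (finite_II m) _ => n _.
    exact: finite_image (finite_II _).
  move=> z [[->|[[n k] /= kf <-]] nUz]; first by case: nUz; apply/eU/ballxx.
  exists n => /=; last by exists k.
  rewrite ltnNge; apply/negP => mn; apply: nUz; apply: eU.
  have nm : n.+1%:R^-1 < e / 2.
    by apply: le_lt_trans me; rewrite lef_pV2 ?posrE // ler_nat.
  rewrite [e]splitr; apply: le_ball (closure_ball (inv_gt0 n) ((yP n).1 k)).
  by rewrite lerD // ltW.
apply: (@tukey_geI (compact_dset N) (omega_power omega_dset)
  (fun f => exist _ _ (cfan f))) => L.
(* [g n] bounds the [k] with [y n k] in [L], so a fan inside [L] forces [f] below [g]. *)
have /choice[g gP] n : exists m, forall k, sval L (y n k) -> (k <= m)%N.
  by have [m mP] := nat_directed ((yP n).2 _ (svalP L)); exists m.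
exists g => f fL; hnf=> n; apply: gP; apply: fL; right.
by exists (n, f n) => /=.
Qed.

Lemma omega_power_ge_compact (K : Type) (b : K -> set N) :
  (forall F : set_system N, ProperFilter F -> cauchy F ->
    exists l : N, F --> l) ->
  basis (range b) -> omega_power (fin_dset K) >=T compact_dset N.
Proof.
move=> Ncomplete [bop bb].
(* Finite sets rather than points are chosen, since [b a] may be empty; together the [d a] form a
   dense set indexed by [K]. *)
have /choice[d dP] a : exists A : set N, finite_set A /\
    (b a !=set0 -> exists2 x, A x & b a x).
  have [[x bx]|nb] := pselect (b a !=set0).
    by exists [set x]; split=> [|_]; [exact: finite_set1|exists x].
  by exists set0; split=> // /nb.
have ddense x e : 0 < e -> exists a y, d a y /\ ball y e x.
  move=> e0; have [_ [[a _ <-] ax] ae] := bb x _ (nbhsx_ballx _ _ e0).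
  have [|y dy by_] := (dP a).2; first by exists x.
  by exists a, y; split=> //; apply/ball_sym/ae.
pose net (F : fin_dset K) := \bigcup_(a in sval F) d a.
have finnet F : finite_set (net F).
  by apply: bigcup_finite (svalP F) _ => a _; case: (dP a).
pose hull (G : omega_power (fin_dset K)) :=
  \bigcap_n \bigcup_(y in net (G n)) closure (ball y n.+1%:R^-1).
have chull G : compact (hull G).
  apply: complete_totally_bounded_compact => //.
    apply: closed_bigI => n _; apply: (@closed_bigcup _ {classic N}) => // y _.
    exact: closed_closure.
  move=> e e0; have [n ne] := ex_inv_lt (divr_gt0 e0 (ltr0Sn R 1)).
  exists (net (G n)) => // x /(_ n I)[y Gy yx]; exists y => //.
  rewrite [e]splitr; apply: le_ball (closure_ball (inv_gt0 n) yx).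
  by rewrite lerD // ltW.
apply/tukey_geP; exists (fun G => exist _ _ (chull G)) => L.
have /choice[F FP] n : exists F : fin_dset K,
    sval L `<=` \bigcup_(y in net F) ball y n.+1%:R^-1.
  have [||F [finF _ LF]] := @compact_finite_subcover _ K (sval L) setT
      (fun a => \bigcup_(y in d a) ball y n.+1%:R^-1) (svalP L).
  - by move=> a _; apply: bigcup_open => y _; exact: open_ball.
  - move=> x _; have [a [y [dy yx]]] := ddense x _ (inv_gt0 n).
    by exists a => //; exists y.
  exists (exist _ F finF) => x /LF[a Fa [y dy yx]].
  by exists y => //; exists a.
exists F => G FG; hnf=> x Lx n _; have [y [a Fa dy] yx] := FP n x Lx.
by exists y; [exists a => //; exact: FG|exact: subset_closure].
Qed.

Lemma compact_ge_fin_weight (K : Type) : has_weight N K ->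
  ~ countable [set: K] -> compact_dset N >=T fin_dset K.
Proof.
move=> [_ minK] ncK.
have /choice[D DP] n : exists S : set N, e_separated n.+1%:R^-1 S /\
    [set: N] `<=` \bigcup_(s in S) ball s n.+1%:R^-1.
  have [S [_ Ssep Scov]] := maximal_separated [set: N] n.+1%:R^-1.
  by exists S; split=> //; exact/Scov/inv_gt0.
pose T := [set p : (nat * nat) * N | D p.1.1 p.2].
pose B := [set ball p.2 p.1.2.+1%:R^-1 | p in T].
have Bb : basis B.
  split; first by move=> _ [p _ <-]; exact: open_ball.
  move=> x U /nbhs_ballP[e /= e0 eU].
  have [n ne] := ex_inv_lt (divr_gt0 e0 (ltr0Sn R 1)).
  have [s Ds sx] := (DP n).2 x I.
  exists (ball s n.+1%:R^-1); first by split=> //; exists ((n, n), s).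
  move=> z sz; apply: eU; rewrite [e]splitr.
  apply: (@ball_triangle _ _ s); last exact: le_ball (ltW ne) _ sz.
  exact/ball_sym/(le_ball (ltW ne)).
have KT := card_le_trans (minK B Bb) (card_image_le _ _).
(* If every [D m] were finite, [T] and hence [K] would be countable. *)
have [m Dm] : exists m, infinite_set (D m).
  apply: contrapT => fin; apply: ncK; apply: sub_countable KT _.
  apply: (@sub_countable _ _ _
    (\bigcup_(q in [set: nat * nat]) [set (q, s) | s in D q.1])).
    by apply: subset_card_le => -[q s] /= Ds; exists q => //; exists s.
  apply: bigcup_countable => // q _.
  apply: finite_set_countable; apply: finite_image.
  by apply: contrapT => Dq; apply: fin; exists q.1.
have [y _ yL] := separated_sequence (inv_gt0 m) (DP m).1 Dm.
have [G [Gtot Ginj]] := card_le_relP KT.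
have /choice[t tP] a : exists p, T p /\ G a p.
  by have [//|p] := Gtot a; exists p.
have tinj : injective t.
  move=> a a' e; apply: (Ginj _ _ (t a)); first by case: (tP a).
  by rewrite e; case: (tP a').
(* The points y separate the indices (n, k): without them, a compact set could
   contain points from infinitely many of the D_n. *)
apply: (@compact_ge_fin _ _ (fun a => [set (t a).2; y (choice.pickle (t a).1)])).
  by move=> a; apply: finite_compact; rewrite finite_setU; split; exact: finite_set1.
move=> L cL.
(* If the code of [a] lies in [L], its second point leaves finitely many index pairs [q], and its
   first lies in [L] and [D q.1], whose intersection is finite. *)
apply: (@sub_finite_set _ _ (t @^-1` \bigcup_(q in choice.pickle @^-1` (y @^-1` L))
  [set (q, s) | s in L `&` D q.1])).
  move=> a aL; exists (t a).1; first by apply: aL; right.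
  exists (t a).2; last by case: (t a).
  by split; [apply: aL; left|case: (tP a)].
apply: finite_preimage => [a a' _ _|]; first exact: tinj.
apply: bigcup_finite => [|q _].
  by apply: finite_preimage (yL _ cL) => q q' _ _ /(pcan_inj choice.pickleK).
apply: finite_image.
exact: compact_separated_finite (inv_gt0 q.1) cL (DP q.1).1.
Qed.

End Metric.

(** * The Tukey type of the compact subsets of a metrizable space *)

Theorem proposition35 (R : realType) (M : topologicalType) (K : Type)
  (metrM : metrizable R M) (weightM : has_weight M K)
  (uncountableK : ~ countable [set: K]) :
  [/\ compact_dset M >=T fin_dset K,
      locally_compact [set: M] -> compact_dset M =T fin_dset K,
      ~ locally_compact [set: M] ->
        compact_dset M >=T prod_dset (omega_power omega_dset) (fin_dset K),
      completely_metrizable R M ->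
        omega_power (fin_dset K) >=T compact_dset M &
      lt_aleph_omega K -> completely_metrizable R M ->
        ~ locally_compact [set: M] ->
        compact_dset M =T omega_power (fin_dset K) /\
        omega_power (fin_dset K) =T
          prod_dset (omega_power omega_dset) (fin_dset K)].
Proof.
have K0 : [set: K] !=set0.
  by apply/set0P/eqP => K0; apply: uncountableK; rewrite K0; exact: countable0.
have ge_fin : compact_dset M >=T fin_dset K.
  have [N MN] := metrM.
  apply: tukey_ge_trans (homeomorphic_compact_ge MN) _.
  exact: compact_ge_fin_weight (homeomorphic_weight MN weightM) uncountableK.
have ge_prod : ~ locally_compact [set: M] ->
    compact_dset M >=T prod_dset (omega_power omega_dset) (fin_dset K).
  move=> nlcM; apply: tukey_ge_prod => //.
  have [N MN] := metrM.
  apply: tukey_ge_trans (homeomorphic_compact_ge MN) _.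
  apply: compact_ge_omega_power => lcN; apply: nlcM.
  exact: homeomorphic_locally_compact (homeomorphic_sym MN) lcN.
have power_ge : completely_metrizable R M ->
    omega_power (fin_dset K) >=T compact_dset M.
  move=> [N Ncomplete MN].
  have [b bb] := weight_basis (homeomorphic_weight MN weightM) K0.
  apply: tukey_ge_trans (omega_power_ge_compact Ncomplete bb) _.
  exact: homeomorphic_compact_ge (homeomorphic_sym MN).
split=> //.
  move=> lcM; split=> //; have [b bb] := weight_basis weightM K0.
  exact: fin_ge_compact bb lcM.
move=> /prod_ge_omega_power_lt_aleph_omega prod_ge cM nlcM.
split; split.
- exact: tukey_ge_trans (ge_prod nlcM) prod_ge.
- exact: power_ge.
- exact: tukey_ge_trans (power_ge cM) (ge_prod nlcM).
- exact: prod_ge.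
Qed.
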